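(* For $n\ge 1$, $a_n(13;2\to 1)=B_n$, the $n$-th Bell number.
   Context: Standard cycle form of $\sigma\in S_n$: product of disjoint cycles (fixed points included), each cycle starting with its largest element, cycles listed in increasing order of largest elements. The fundamental bijection $\theta:S_n\to S_n$ erases the parentheses of the standard cycle form to give a one-line permutation. For $\pi\in S_n$, $\hat\pi=\theta^{-1}(\pi)$. An arrow pattern $(\nu;H)$ of size $k$: a string $\nu=a_1\dots a_m$ of positive integers and a set $H$ of arrows $b\to c$, with all integers appearing forming $[k]$. $\pi\in S_n$ contains $(\nu;H)$ if there is $X=\{x_1<\dots<x_k\}\subseteq[n]$ with positions $t_1<\dots<t_m$ such that $\pi_{t_1}\cdots\pi_{t_m}=x_{a_1}\cdots x_{a_m}$ and $\hat\pi(x_b)=x_c$ for every arrow $b\to c\in H$; otherwise it avoids it. $a_n(\nu;H)$ = number of $\pi\in S_n$ avoiding $(\nu;H)$. $B_n$ is the number of set partitions of $[n]$. *)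

(* Defs.v *)
From mathcomp Require Import all_boot all_order all_fingroup.

Set Implicit Arguments.
Unset Strict Implicit.
Unset Printing Implicit Defensive.

(* Throughout, [n] = {1, ..., n} is represented by 'I_n = {0, ..., n - 1}
   (shift by one), and the one-line notation of pi : 'S_n is the word
   pi 0, pi 1, ..., pi (n - 1).                                             *)

Section FundamentalBijection.

Variable n : nat.
Implicit Types (s t pi : 'S_n) (m i : 'I_n).

Definition cycle_max s m := [forall i in porbit s m, i <= m].

Definition cycle_from s m : seq 'I_n := traject s m #|porbit s m|.

(* enum 'I_n is increasing, hence so are the largest elements of the
   successive cycles.                                                       *)
Definition standard_cycle_form s : seq (seq 'I_n) :=
  [seq cycle_from s m | m <- enum 'I_n & cycle_max s m].

Definition theta_word s : seq 'I_n := flatten (standard_cycle_form s).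

Lemma mem_cycle_from s m i : (i \in cycle_from s m) = (i \in porbit s m).
Proof. by rewrite porbit_traject. Qed.

Lemma cycle_fromE s m :
  cycle_from s m = m :: traject s (s m) #|porbit s m|.-1.
Proof.
rewrite /cycle_from; case E: #|porbit s m| => [|k] //.
by move: (card_porbit_neq0 s m); rewrite E.
Qed.

Lemma theta_word_uniq s : uniq (theta_word s).
Proof.
have maxl: all (cycle_max s) [seq m <- enum 'I_n | cycle_max s m].
  exact: filter_all.
have := filter_uniq (cycle_max s) (enum_uniq 'I_n).
rewrite /theta_word /standard_cycle_form.
elim: (filter _ _) maxl => //= m l IH /andP[mm ml] /andP[mNl ul].
rewrite cat_uniq IH // andbT {1}/cycle_from uniq_traject_porbit /=.
apply/hasPn => x /flatten_mapP[m' m'l xm']; apply/negP => xm.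
move: xm xm'; rewrite /= !mem_cycle_from => xm xm'.
suff Em: m = m' by rewrite Em m'l in mNl.
have Eo: porbit s m = porbit s m'.
  by apply/eqP; rewrite eq_porbit_mem porbit_sym; move: xm xm';
     rewrite -!eq_porbit_mem => /eqP <- /eqP ->.
apply: val_inj; apply/eqP; rewrite /= eqn_leq.
have /forall_inP mmax := mm.
have /forall_inP mmax' := allP ml _ m'l.
by rewrite mmax' ?mmax // ?Eo ?porbit_id // -Eo porbit_id.
Qed.

Lemma mem_theta_word s i : i \in theta_word s.
Proof.
have [m mi mmax] := @arg_maxnP _ i (mem (porbit s i)) val (porbit_id s i).
have Eo: porbit s m = porbit s i by apply/eqP; rewrite eq_porbit_mem.
apply/flatten_mapP; exists m; last by rewrite mem_cycle_from Eo porbit_id.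
rewrite mem_filter mem_enum andbT; apply/forall_inP => j.
by rewrite Eo => /mmax.
Qed.

Lemma size_theta_word s : size (theta_word s) = n.
Proof.
rewrite -[RHS]size_enum_ord; apply/perm_size/uniq_perm.
- exact: theta_word_uniq.
- exact: enum_uniq.
by move=> i; rewrite mem_theta_word mem_enum.
Qed.

Lemma theta_subproof s :
  injective (fun i : 'I_n => nth i (theta_word s) i).
Proof.
move=> i j; rewrite (set_nth_default i j) ?size_theta_word // => /eqP.
by rewrite nth_uniq ?theta_word_uniq ?size_theta_word // => /eqP /val_inj.
Qed.

(* The default value i of nth is never reached, by size_theta_word.         *)
Definition theta s : 'S_n := perm (@theta_subproof s).

Lemma theta_one_line s : [seq theta s i | i <- enum 'I_n] = theta_word s.
Proof.
have [/size0nil w0 | [i0 _]] : size (theta_word s) = 0 \/ exists i : 'I_n, True.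
- rewrite size_theta_word; case: (posnP n) => [| n_gt0]; first by left.
  by right; exists (Ordinal n_gt0).
- by rewrite w0; apply: size0nil;
     rewrite size_map size_enum_ord -(size_theta_word s) w0.
apply: (@eq_from_nth _ i0); first by rewrite size_map size_enum_ord size_theta_word.
move=> j; rewrite size_map size_enum_ord => ltj.
rewrite (nth_map i0) ?size_enum_ord // permE nth_enum_ord //.
by apply: set_nth_default; rewrite size_theta_word.
Qed.

Local Definition block (p : 'I_n * seq 'I_n) := p.1 :: p.2.

Local Definition standard (ps : seq ('I_n * seq 'I_n)) :=
  all (fun p : 'I_n * seq 'I_n => all (fun j : 'I_n => j < p.1) p.2) ps
  && pairwise (fun p q : 'I_n * seq 'I_n => p.1 < q.1) ps.

Local Lemma split_standard m r ps :
  standard ((m, r) :: ps) ->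
  find (fun j : 'I_n => m < j) (r ++ flatten (map block ps)) = size r.
Proof.
case/andP=> /= /andP[rm _] /andP[mps _].
rewrite find_cat (negPf (_ : ~~ has _ r)).
  by case: ps mps => [|q ps] /=; rewrite ?addn0 // => /andP[-> _]; rewrite addn0.
by apply/hasPn => j /(allP rm) lt_jm; rewrite -leqNgt ltnW.
Qed.

Local Lemma standard_flatten_inj ps qs :
  standard ps -> standard qs ->
  flatten (map block ps) = flatten (map block qs) -> ps = qs.
Proof.
elim: ps qs => [|[m r] ps IH] [|[m' r'] qs] //= sp sq [Em Ew].
subst m'; have Es : size r = size r'.
  by rewrite -(split_standard sp) -(split_standard sq) Ew.
move/eqP: Ew; rewrite eqseq_cat // => /andP[/eqP <- /eqP Ef].
congr (_ :: _); apply: IH Ef.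
- by case/andP: sp => /= /andP[_ ?] /andP[_ ?]; apply/andP.
- by case/andP: sq => /= /andP[_ ?] /andP[_ ?]; apply/andP.
Qed.

Local Definition split_form s : seq ('I_n * seq 'I_n) :=
  [seq (m, traject s (s m) #|porbit s m|.-1)
     | m <- enum 'I_n & cycle_max s m].

Local Lemma split_formE s : map block (split_form s) = standard_cycle_form s.
Proof. by rewrite -map_comp; apply: eq_map => m; rewrite cycle_fromE. Qed.

Local Lemma standard_split_form s : standard (split_form s).
Proof.
apply/andP; split.
  apply/allP => _ /mapP[m + ->] /=; rewrite mem_filter => /andP[mm _].
  have := uniq_traject_porbit s m.
  rewrite -/(cycle_from s m) cycle_fromE /= => /andP[mN _].
  apply/allP => j jt; have /forall_inP/(_ j) := mm.
  rewrite -mem_cycle_from cycle_fromE in_cons => /(_ (introT orP (or_intror jt))).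
  by rewrite leq_eqVlt => /orP[/eqP/val_inj Ej | //]; subst j; case/negP: mN.
rewrite pairwise_map; apply: pairwise_filter.
rewrite -(pairwise_map val ltn) val_enum_ord.
by rewrite -sorted_pairwise ?iota_ltn_sorted //; apply: ltn_trans.
Qed.

Lemma standard_cycle_form_inj : injective standard_cycle_form.
Proof.
move=> s t Est; apply/permP => i.
have : i \in flatten (standard_cycle_form s) by exact: mem_theta_word.
case/flatten_mapP=> m mP im; have : cycle_from s m \in standard_cycle_form t.
  by rewrite -Est map_f.
case/mapP=> m' _ E; have Em : m = m' by move: E; rewrite !cycle_fromE => -[].
subst m'; have Ek : #|porbit s m| = #|porbit t m|.
  by have := congr1 size E; rewrite !size_traject.
have Ei j : j < #|porbit s m| -> iter j s m = iter j t m.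
  move=> ltj; have := congr1 (fun c => nth m c j) E.
  by rewrite !nth_traject // -Ek.
case/trajectP: im => j ltj ->; rewrite -iterS [in RHS]Ei // -iterS.
case: (ltngtP j.+1 #|porbit s m|) => [/Ei // | | Ej].
  by rewrite ltnNge ltj.
by rewrite Ej iter_porbit Ek iter_porbit.
Qed.

Lemma theta_inj : injective theta.
Proof.
move=> s t Est; apply: standard_cycle_form_inj.
rewrite -!split_formE; congr map.
apply: standard_flatten_inj; try exact: standard_split_form.
by rewrite !split_formE -!/(theta_word _) -!theta_one_line Est.
Qed.

Definition hat pi : 'S_n := invF theta_inj pi.

Lemma hatK : cancel hat theta.
Proof. exact: f_invF. Qed.

Lemma thetaK : cancel theta hat.
Proof. exact: invF_f. Qed.

End FundamentalBijection.

(* The integers 1, ..., k are represented by the elements 0, ..., k - 1 of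
   'I_k; an arrow b -> c is the pair (b, c).                                *)
Record arrow_pattern (k : nat) := ArrowPattern {
  pattern_word : seq 'I_k;
  pattern_arrows : {set 'I_k * 'I_k};
  pattern_full : [forall i, (i \in pattern_word)
    || [exists bc in pattern_arrows, (i == bc.1) || (i == bc.2)]]
}.

Definition increasing k n (f : {ffun 'I_k -> 'I_n}) :=
  [forall i : 'I_k, forall j : 'I_k, (i < j) ==> (f i < f j)].

(* x enumerates X = {x_1 < ... < x_k}; t gives the positions
   t_1 < ... < t_m of the letters.                                          *)
Definition occurrence k (p : arrow_pattern k) n (pi : 'S_n)
    (x : {ffun 'I_k -> 'I_n})
    (t : {ffun 'I_(size (pattern_word p)) -> 'I_n}) :=
  [&& increasing x, increasing t,
      [forall j, pi (t j) == x (tnth (in_tuple (pattern_word p)) j)]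
    & [forall bc in pattern_arrows p, hat pi (x bc.1) == x bc.2]].
Arguments occurrence [k] p [n] pi x t.

Definition contains k (p : arrow_pattern k) n (pi : 'S_n) : bool :=
  [exists x, exists t, occurrence p pi x t].

Definition avoiders k (p : arrow_pattern k) n : {set 'S_n} :=
  [set pi | ~~ contains p pi].

Definition bell n := #|[set P : {set {set 'I_n}} | partition P [set: 'I_n]]|.

Definition letter1 : 'I_3 := @Ordinal 3 0 isT.
Definition letter2 : 'I_3 := @Ordinal 3 1 isT.
Definition letter3 : 'I_3 := @Ordinal 3 2 isT.

Lemma pattern_13_2to1_subproof :
  [forall i, (i \in [:: letter1; letter3])
    || [exists bc in [set (letter2, letter1)], (i == bc.1) || (i == bc.2)]].
Proof.
apply/forallP => i; rewrite !inE; case: i => [[|[|[|//]]] ?] //=.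
by apply/existsP; exists (letter2, letter1); rewrite inE eqxx.
Qed.

Definition pattern_13_2to1 : arrow_pattern 3 :=
  ArrowPattern pattern_13_2to1_subproof.

(* Main.v *)
Require Import Defs.
From mathcomp Require Import all_boot all_order all_fingroup.

Set Implicit Arguments.
Unset Strict Implicit.
Unset Printing Implicit Defensive.

(** Cycles of the standard cycle form start at left-to-right maxima, so the
    descents [a b] of [pi] are exactly the arrows [a -> b] of [hat pi] with
    [b < a].  Hence [pi] avoids [(13; 2 -> 1)] iff no descent [a b] is followed
    by a value larger than [a], i.e. iff [pi] is a concatenation of increasing
    runs whose maxima are its right-to-left maxima.  Such a permutation is
    encoded by the idempotent map [M] with [x <= M x] which sends [x] to the
    largest value at or after the position of [x].  Set partitions are encoded
    by the same kind of map, sending [x] to the maximum of its block.  *)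

(** * Descending arrows of [hat pi] as descents of [pi] *)

Section DescentsAndArrows.

Variables (n : nat) (s : 'S_n).

(** The two ways [y] can follow [x] in the word: inside a cycle, or at a junction, where [s x] is
    the maximum of the cycle that [x] closes and [y] is the larger maximum opening the next one. *)
Let step : rel 'I_n := fun x y => (s x == y) || ((x <= s x) && (x < y)).

Lemma last_cycle_from m : s (last m (cycle_from s m)) = m.
Proof.
rewrite cycle_fromE /= (last_traject s m) -iterS prednK ?iter_porbit //.
by rewrite lt0n card_porbit_neq0.
Qed.

Lemma cycle_max_mem m x : cycle_max s m -> x \in cycle_from s m -> x <= m.
Proof. by move=> /forall_inP mm; rewrite mem_cycle_from => /mm. Qed.

(** The last letter of a cycle is at most the cycle maximum, which lies below the next one, so
    junctions satisfy [step]. The final letter of the word needs its own clause, having no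
    successor: [s] sends it back to its cycle maximum. *)
Lemma sorted_step_cycles (ms : seq 'I_n) x0 :
    all (cycle_max s) ms -> sorted (fun y z : 'I_n => y < z) ms ->
  let w := flatten [seq cycle_from s m | m <- ms] in
  sorted step w /\ (ms != [::] -> last x0 w <= s (last x0 w)).
Proof.
elim: ms x0 => [//|m ms IH] x0 /= /andP[mm ams] pms.
(* [last_cat] will make the last letter of the first cycle the default value for the rest. *)
have [sw lw] := IH (last m (cycle_from s m)) ams (path_sorted pms).
have le_last : last m (cycle_from s m) <= m.
  by apply: cycle_max_mem mm _; rewrite cycle_fromE /= mem_last.
have sl := last_cycle_from m.
have path_cycle : path step m (traject s (s m) #|porbit s m|.-1).
  apply: (sub_path (e := frel s)); last exact: fpath_traject.
  by move=> y z /= yz; rewrite /step yz.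
have lastE x : last x (cycle_from s m) = last m (cycle_from s m).
  by rewrite cycle_fromE.
rewrite last_cat lastE; split=> [|_]; last first.
  by case: (ms) lw => [_ | m' ms' lw]; [rewrite /= sl | exact: lw].
rewrite cycle_fromE /= cat_path path_cycle /=.
have -> : last m (traject s (s m) #|porbit s m|.-1) = last m (cycle_from s m).
  by rewrite cycle_fromE.
case: (ms) pms sw => //= m' ms' /andP[ltmm' _]; rewrite cycle_fromE /= => ->.
by rewrite /step sl le_last (leq_ltn_trans le_last) ?orbT.
Qed.

Lemma sorted_step_theta_word x0 :
  sorted step (theta_word s) /\
  (theta_word s != [::] -> last x0 (theta_word s) <= s (last x0 (theta_word s))).
Proof.
have [||sw lw] := @sorted_step_cycles [seq m <- enum 'I_n | cycle_max s m] x0.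
- exact: filter_all.
- apply: sorted_filter; first by move=> a b c; exact: ltn_trans.
  rewrite -[sorted _ _]/(sorted (relpre val ltn) _) -sorted_map.
  by rewrite val_enum_ord iota_ltn_sorted.
split=> // wn0; apply: lw; apply: contraNneq wn0 => ms0.
by rewrite /theta_word /standard_cycle_form ms0.
Qed.

End DescentsAndArrows.

(** A letter that closes its cycle is sent to a value at least as large, so an arrow down from [a]
    stays inside a cycle and its target follows [a]. Conversely a junction is an ascent, so a
    descent must be an arrow. *)
Lemma hat_descent n (pi : 'S_n) (a b : 'I_n) : b < a ->
  (hat pi a == b) = (pi^-1%g b == (pi^-1%g a).+1 :> nat).
Proof.
move=> ltba; set s := hat pi.
have piE i : pi i = nth a (theta_word s) i.
  rewrite -[pi](hatK pi) -/s permE.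
  by apply: set_nth_default; rewrite size_theta_word.
have [stepw lastw] := sorted_step_theta_word s a.
have {}stepw (i j : 'I_n) : j = i.+1 :> nat ->
    (s (pi i) == pi j) || ((pi i <= s (pi i)) && (pi i < pi j)).
  move=> Ej; rewrite [pi j]piE Ej [pi i]piE.
  by move/sortedP: stepw; apply; rewrite -Ej size_theta_word.
apply/eqP/eqP => [Esa | /stepw]; last first.
  rewrite !permKV => /orP[/eqP // | /andP[_ ltab]].
  by have := ltn_trans ltab ltba; rewrite ltnn.
have [lti | gei] := ltnP (pi^-1%g a).+1 n.
  have := stepw (pi^-1%g a) (Ordinal lti) erefl.
  rewrite permKV Esa leqNgt ltba orbF => /eqP Eb.
  by rewrite Eb permK.
(* Here [a] is the final letter, so [a <= s a], against [b < a]. *)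
have wn0 : theta_word s != [::].
  by rewrite -size_eq0 size_theta_word -lt0n (leq_ltn_trans _ (ltn_ord a)).
have := lastw wn0; rewrite -nth_last size_theta_word.
have -> : n.-1 = pi^-1%g a :> nat.
  have En : n = (pi^-1%g a).+1 by apply/eqP; rewrite eqn_leq gei ltn_ord.
  by rewrite [in LHS]En.
by rewrite -piE permKV Esa leqNgt ltba.
Qed.

(** The values [b], [a], [c] play the letters 1, 2, 3; [hat_descent] turns the arrow into adjacency
    of [a] and [b]. *)
Lemma contains_13_2to1P n (pi : 'S_n) :
  reflect (exists a b c : 'I_n,
    [/\ pi^-1%g b = (pi^-1%g a).+1 :> nat, pi^-1%g b < pi^-1%g c, b < a & a < c])
  (contains pattern_13_2to1 pi).
Proof.
pose j0 : 'I_(size (pattern_word pattern_13_2to1)) := @Ordinal 2 0 isT.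
pose j1 : 'I_(size (pattern_word pattern_13_2to1)) := @Ordinal 2 1 isT.
apply: (iffP existsP) => [[x /existsP[t /and4P[incx inct /forallP occ arr]]] | ].
  have incxP (i j : 'I_3) : i < j -> x i < x j.
    by move=> ltij; move: incx => /forallP/(_ i)/forallP/(_ j)/implyP; apply.
  have ltt : t j0 < t j1.
    by move: inct => /forallP/(_ j0)/forallP/(_ j1)/implyP; apply.
  exists (x letter2), (x letter1), (x letter3).
  have := occ j0; have := occ j1.
  rewrite !(tnth_nth letter1) /= => /eqP E3 /eqP E1.
  have lt12 : x letter1 < x letter2 by exact: incxP.
  split=> //; last exact: incxP.
    apply/eqP; rewrite -hat_descent //.
    by move: arr => /forall_inP/(_ (letter2, letter1)); rewrite inE eqxx; apply.
  by rewrite -E1 -E3 !permK.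
case=> a [b [c [Eab ltbc ltba ltac]]].
exists [ffun i : 'I_3 => nth a [:: b; a; c] i].
apply/existsP.
exists [ffun i : 'I_(size (pattern_word pattern_13_2to1)) =>
          pi^-1%g (nth a [:: b; c] i)].
have ltbc' := ltn_trans ltba ltac.
apply/and4P; split.
- apply/forallP => -[[|[|[|//]]] ?]; apply/forallP => -[[|[|[|//]]] ?];
  by apply/implyP; rewrite !ffunE.
- apply/forallP => -[[|[|//]] ?]; apply/forallP => -[[|[|//]] ?];
  by apply/implyP; rewrite !ffunE.
- by apply/forallP => -[[|[|//]] ?]; rewrite !ffunE (tnth_nth letter1) /= permKV.
apply/forall_inP => bc; rewrite inE => /eqP ->; rewrite !ffunE /=.
by rewrite hat_descent // Eab.
Qed.

(** * Inflating idempotent maps and set partitions *)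

Definition inflating_idempotents n : {set {ffun 'I_n -> 'I_n}} :=
  [set M : {ffun 'I_n -> 'I_n} | [forall x : 'I_n, (x <= M x) && (M (M x) == M x)]].

Lemma inflating_idempotentsP n (M : {ffun 'I_n -> 'I_n}) :
  reflect ((forall x : 'I_n, x <= M x) /\ (forall x, M (M x) = M x))
          (M \in inflating_idempotents n).
Proof.
rewrite inE; apply: (iffP forallP) => [H | [le_M MM] x].
  by split=> x; case/andP: (H x) => // _ /eqP.
by rewrite le_M MM eqxx.
Qed.

(** The bijection sends [M] to the partition into its fibres; [M x] is the largest element of the
    fibre of [x]. *)
Lemma card_inflating_idempotents n : #|inflating_idempotents n| = bell n.
Proof.
pose K (M : {ffun 'I_n -> 'I_n}) := preim_partition M [set: 'I_n].
rewrite /bell -(card_in_imset (f := K)); last first.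
  move=> M1 M2 /inflating_idempotentsP[le1 MM1] /inflating_idempotentsP[le2 MM2] EK.
  have mem12 x y : (M1 x == M1 y) = (M2 x == M2 y).
    have := pblock_equivalence_partition (R := fun x y => M1 x == M1 y)
                                         (D := [set: 'I_n]).
    have := pblock_equivalence_partition (R := fun x y => M2 x == M2 y)
                                         (D := [set: 'I_n]).
    rewrite -/(preim_partition M1 setT) -/(preim_partition M2 setT) -/(K M1) -/(K M2) EK.
    move=> H2 H1; rewrite -H1 -?H2 ?inE //; split=> // /eqP -> //.
  apply/ffunP => x; apply/val_inj/eqP; rewrite /= eqn_leq.
  (* [x] and [M1 x] share a fibre, so [M2 x = M2 (M1 x) >= M1 x]; the other inequality is
     symmetric. *)
  have /eqP E1 : M2 x == M2 (M1 x) by rewrite -mem12 MM1.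
  have /eqP E2 : M1 x == M1 (M2 x) by rewrite mem12 MM2.
  by rewrite {1}E1 le2 /= E2 le1.
apply: eq_card => P; rewrite [RHS]inE; apply/imsetP/idP => [[M _ ->] | partP].
  exact: preim_partitionP.
have tiP := partition_trivIset partP.
have inP x : x \in cover P by rewrite (cover_partition partP) inE.
(* The preimage of [P] sends each point to the maximum of its block. *)
pose M := [ffun x => [arg max_(y > x in pblock P x) val y]].
have MP x : M x \in pblock P x /\ forall y, y \in pblock P x -> y <= M x.
  by rewrite ffunE; case: arg_maxnP => //=; rewrite mem_pblock.
have EM x : pblock P (M x) = pblock P x.
  by apply/esym/eqP; rewrite eq_pblock //; case: (MP x).
have congM x y : pblock P x = pblock P y -> M x = M y.
  move=> Exy; apply/val_inj/eqP; rewrite /= eqn_leq.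
  have [Mx leMx] := MP x; have [My leMy] := MP y.
  by rewrite leMy -?Exy // leMx // Exy.
exists M.
  apply/inflating_idempotentsP; split=> x; first by apply: (MP x).2; rewrite mem_pblock.
  exact/congM/EM.
rewrite -[LHS](equivalence_partition_pblock partP).
apply: eq_imset => x; apply/setP => y; rewrite !inE /=.
by rewrite -eq_pblock //; apply/eqP/eqP => [/congM // | Exy]; rewrite -(EM x) Exy EM.
Qed.

(** * Avoiders and their suffix maxima *)

Section AvoidersAsSuffixMaxima.

Variable n : nat.
Implicit Types (pi : 'S_n) (M : {ffun 'I_n -> 'I_n}) (x y : 'I_n).

Definition suffix_max pi : {ffun 'I_n -> 'I_n} :=
  [ffun x => [arg max_(y > x | pi^-1%g x <= pi^-1%g y) val y]].

Lemma suffix_maxP pi x :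
  pi^-1%g x <= pi^-1%g (suffix_max pi x) /\
  forall y, pi^-1%g x <= pi^-1%g y -> y <= suffix_max pi x.
Proof. by rewrite ffunE; case: arg_maxnP. Qed.

Lemma suffix_max_anti pi x y :
  pi^-1%g x <= pi^-1%g y -> suffix_max pi y <= suffix_max pi x.
Proof.
move=> le_xy; apply: (suffix_maxP pi x).2.
exact: leq_trans (suffix_maxP pi y).1.
Qed.

Lemma suffix_max_inflating pi : suffix_max pi \in inflating_idempotents n.
Proof.
apply/inflating_idempotentsP; split=> x; first exact: (suffix_maxP pi x).2.
apply/val_inj/eqP; rewrite /= eqn_leq (suffix_maxP pi (suffix_max pi x)).2 // andbT.
exact/suffix_max_anti/(suffix_maxP pi x).1.
Qed.

(* The order of appearance of the values in the avoider encoded by [M]. *)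
Definition before M x y := (M y < M x) || ((M x == M y) && (x < y)).

Lemma before_irr M x : before M x x = false.
Proof. by rewrite /before !ltnn andbF. Qed.

Lemma before_trans M : transitive (before M).
Proof.
move=> y x z; rewrite /before => /orP[lt1|/andP[/eqP E1 lt1]]
  /orP[lt2|/andP[/eqP E2 lt2]].
- by rewrite (ltn_trans lt2 lt1).
- by rewrite -E2 lt1.
- by rewrite E1 lt2.
- by rewrite E1 E2 eqxx (ltn_trans lt1 lt2) orbT.
Qed.

Lemma before_total M x y : x != y -> before M x y || before M y x.
Proof.
rewrite /before eq_sym (eq_sym (M y)) -!(inj_eq val_inj) /=.
by case: (ltngtP (M x) (M y)) => //= _; case: (ltngtP x y).
Qed.

Lemma before_asym M x y : before M x y -> before M y x = false.
Proof.
move=> Mxy; apply/negP => Myx.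
by have := before_trans Mxy Myx; rewrite before_irr.
Qed.

(** Suffix maxima weakly decrease along the word. When [x] and a later [y] share the suffix maximum
    [m], a descent between them would be followed by [m] and form the pattern, so the values climb
    from [x] to [y]. *)
Lemma avoiders_before pi x y : pi \in avoiders pattern_13_2to1 n ->
  (pi^-1%g x < pi^-1%g y) = before (suffix_max pi) x y.
Proof.
rewrite inE => /contains_13_2to1P avoid.
(* [before] is irreflexive and asymmetric and positions are distinct, so one implication
   suffices. *)
wlog suff before_of_lt : x y / pi^-1%g x < pi^-1%g y -> before (suffix_max pi) x y.
  apply/idP/idP => [|bxy]; first exact: before_of_lt.
  case: (ltngtP (pi^-1%g x) (pi^-1%g y)) => // [/before_of_lt | /val_inj/perm_inj Exy].
    by rewrite before_asym.
  by move: bxy; rewrite Exy before_irr.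
move=> ltxy; have := suffix_max_anti (ltnW ltxy).
rewrite leq_eqVlt /before => /orP[/eqP/val_inj EM|->//].
rewrite EM eqxx ltnn /=.
set m := suffix_max pi y in EM.
suff climb k : pi^-1%g x + k <= pi^-1%g y ->
    forall z, pi^-1%g z = pi^-1%g x + k :> nat -> x <= z.
  have /climb/(_ y) : pi^-1%g x + (pi^-1%g y - pi^-1%g x) <= pi^-1%g y.
    by rewrite subnKC // ltnW.
  rewrite (subnKC (ltnW ltxy)) => /(_ erefl).
  rewrite leq_eqVlt => /orP[/eqP/val_inj Exy|//].
  by rewrite Exy ltnn in ltxy.
elim: k => [_ z | k IH lek z Ez]; first by rewrite addn0 => /val_inj/perm_inj ->.
have ltk : pi^-1%g x + k < n.
  by rewrite (leq_ltn_trans _ (ltn_ord (pi^-1%g y))) // ltnW // -addnS.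
pose u := pi (Ordinal ltk).
have Eu : pi^-1%g u = pi^-1%g x + k :> nat by rewrite permK.
have lexu : x <= u by apply: IH Eu; rewrite ltnW // -addnS.
apply: leq_trans lexu _; rewrite leqNgt; apply/negP => ltzu.
(* [u z] is then a descent, and [m >= u] comes after it. *)
have leum : u <= m by rewrite EM (suffix_maxP pi x).2 // Eu leq_addr.
have leym : pi^-1%g y <= pi^-1%g m by exact: (suffix_maxP pi y).1.
have lezm : pi^-1%g z <= pi^-1%g m by rewrite Ez (leq_trans lek).
apply: avoid; exists u, z, m; split=> //; first by rewrite Ez Eu addnS.
(* Strictness: [m] is not [z], as [z < u <= m], and not [u], which stands before [z]. *)
- rewrite ltn_neqAle lezm andbT; apply/eqP => /val_inj/perm_inj Ezm.
  by move: ltzu; rewrite Ezm ltnNge leum.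
- rewrite ltn_neqAle leum andbT; apply/eqP => /val_inj Eum.
  by move: lezm; rewrite -Eum Ez Eu addnS ltnn.
Qed.

Lemma rank_before_subproof M x : #|[pred y | before M y x]| < n.
Proof.
rewrite -[X in _ < X]card_ord; apply: proper_card.
by apply/properP; split; [exact/subsetP | exists x => //; rewrite inE before_irr].
Qed.

Definition rank_before M x : 'I_n := Ordinal (rank_before_subproof M x).

Lemma rank_before_lt M x y : before M x y -> rank_before M x < rank_before M y.
Proof.
move=> Mxy; apply: proper_card; apply/properP; split.
  by apply/subsetP => z; rewrite !inE => /before_trans; apply.
by exists x; rewrite inE ?before_irr.
Qed.

Lemma rank_before_inj M : injective (rank_before M).
Proof.
move=> x y Exy; apply/eqP/negPn/negP => /(before_total M).
by case/orP => /rank_before_lt; rewrite Exy ltnn.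
Qed.

(** The rank of a value is its position, hence the inverse. *)
Definition perm_before M : 'S_n := (perm (@rank_before_inj M))^-1%g.

Lemma perm_before_lt M x y :
  ((perm_before M)^-1%g x < (perm_before M)^-1%g y) = before M x y.
Proof.
rewrite /perm_before invgK !permE; apply/idP/idP => [lt_xy|/rank_before_lt //].
have /(before_total M)/orP[//|/rank_before_lt] : x != y.
  by apply: contraTneq lt_xy => ->; rewrite ltnn.
by rewrite ltnNge ltnW.
Qed.

(** The position of [x] counts the values placed earlier, which by [avoiders_before] is the rank of
    [x]. *)
Lemma avoiders_perm_before pi : pi \in avoiders pattern_13_2to1 n ->
  pi = perm_before (suffix_max pi).
Proof.
move=> av; apply: invg_inj; rewrite /perm_before invgK.
apply/permP => x; rewrite [RHS]permE; apply/esym/val_inj.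
have card_before : #|[pred y | before (suffix_max pi) y x]|
        = #|pi^-1%g @^-1: [set i : 'I_n | i < pi^-1%g x]|.
  by apply: eq_card => y; rewrite !inE avoiders_before.
apply: etrans card_before _.
rewrite on_card_preimset; last exact/onW_bij/injF_bij/perm_inj.
have le_xn := ltnW (ltn_ord (pi^-1%g x)).
rewrite -sum1_card (eq_bigl (fun i : 'I_n => i < pi^-1%g x)) => [|i]; last by rewrite inE.
by rewrite (big_ord_narrow le_xn) sum1_card card_ord.
Qed.

(** In an occurrence [M b < M a], and [a < c <= M c <= M b] gives [a < M a]. Then [M a] stands
    strictly between the adjacent letters [a] and [b]. *)
Lemma perm_before_avoids M : M \in inflating_idempotents n ->
  perm_before M \in avoiders pattern_13_2to1 n.
Proof.
move=> /inflating_idempotentsP[leM MM]; rewrite inE; apply/contains_13_2to1P.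
case=> a [b [c [Eab]]]; rewrite perm_before_lt => bbc ltba ltac.
have /orP[ltMba | /andP[_ ltab]] : before M a b by rewrite -perm_before_lt Eab.
  have leMcb : M c <= M b by case/orP: bbc => [/ltnW | /andP[/eqP -> _]].
  have ltaM : a < M a.
    by rewrite (leq_trans ltac) // (leq_trans (leM c)) // (leq_trans leMcb) // ltnW.
  have : before M a (M a) by rewrite /before MM eqxx ltaM orbT.
  have : before M (M a) b by rewrite /before MM ltMba.
  by rewrite -!perm_before_lt Eab ltnS leqNgt => /negP.
by rewrite ltnNge ltnW in ltab.
Qed.

(** A value [m] at or after [x] has [m <= M m <= M x], and [M x] itself is such a value, since it
    ties with [x] under [M] and is not smaller. *)
Lemma suffix_max_perm_before M : M \in inflating_idempotents n ->
  suffix_max (perm_before M) = M.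
Proof.
move=> /inflating_idempotentsP[leM MM]; apply/ffunP => x.
apply/val_inj/eqP; rewrite /= eqn_leq; apply/andP; split.
  have := (suffix_maxP (perm_before M) x).1.
  set m := suffix_max _ x; rewrite leqNgt perm_before_lt /before negb_or -leqNgt.
  by case/andP=> leMm _; rewrite (leq_trans (leM m)).
apply: (suffix_maxP (perm_before M) x).2.
by rewrite leqNgt perm_before_lt /before MM ltnn eqxx /= -leqNgt.
Qed.

End AvoidersAsSuffixMaxima.

Theorem theorem5p2 (n : nat) (hn : 1 <= n) :
  #|avoiders pattern_13_2to1 n| = bell n.
Proof.
rewrite -card_inflating_idempotents.
rewrite -(card_in_imset (f := @suffix_max n)); last first.
  move=> pi1 pi2 av1 av2 E.
  by rewrite (avoiders_perm_before av1) E -avoiders_perm_before.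
apply: eq_card => M; apply/imsetP/idP => [[pi _ ->] | MD].
  exact: suffix_max_inflating.
by exists (perm_before M); [exact: perm_before_avoids | rewrite suffix_max_perm_before].
Qed.
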